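(* Let $j$ and $n$ be integers with $1\leq j\leq n$ and let $A\in\mathbb{C}^{n\times n}$ be a nondefective (i.e. diagonalizable) matrix, diagonalized as $A=V\Lambda V^{-1}$ with $V$ nonsingular and $\Lambda$ diagonal. Assume the eigenvalues of $A$ are real and ordered (with multiplicity) as $\lambda_{1}\leq\cdots\leq\lambda_{n}$. Then $$\lambda_{j}=\min_{\mathbf{S}^{j}}\ \max_{\substack{x\in\mathbf{S}^{j}\\ y=(VV^{*})^{-1}x\\ y^{*}x\neq 0}}\frac{y^{*}Ax}{y^{*}x}=\max_{\mathbf{S}^{n-j+1}}\ \min_{\substack{q\in \mathbf{S}^{n-j+1}\\ p=(VV^{*})^{-1}q\\ p^{*}q\neq 0}}\frac{p^{*}Aq}{p^{*}q},$$ where the outer minimum is over all $j$-dimensional subspaces $\mathbf{S}^{j}$ of $\mathbb{C}^{n}$ and the outer maximum is over all $(n-j+1)$-dimensional subspaces $\mathbf{S}^{n-j+1}$ of $\mathbb{C}^{n}$.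
   Context: $X^{*}$ denotes the conjugate transpose; vectors are column vectors. *)

(* Defs.v *)
From mathcomp Require Import all_boot all_order all_algebra.
From mathcomp Require Import spectral complex.
From mathcomp Require Import classical_sets reals.

Set Implicit Arguments.
Unset Strict Implicit.
Unset Printing Implicit Defensive.

Import Order.TTheory GRing.Theory Num.Theory.

Local Open Scope classical_set_scope.
Local Open Scope sesquilinear_scope.
Local Open Scope ring_scope.

Section Extrema.
Variables (d : Order.disp_t) (T : porderType d).

Definition is_max (E : set T) (m : T) : Prop := E m /\ ubound E m.
Definition is_min (E : set T) (m : T) : Prop := E m /\ lbound E m.

(* [is_minmax P E m] reads m = min_(S | P S) max (E S): the inner maximum has
   to be attained for every S in P, not only for an optimal one. *)
Definition is_minmax (I : Type) (P : set I) (E : I -> set T) (m : T) : Prop :=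
  exists2 f : I -> T, (forall S, P S -> is_max (E S) (f S)) & is_min (f @` P) m.

Definition is_maxmin (I : Type) (P : set I) (E : I -> set T) (m : T) : Prop :=
  exists2 f : I -> T, (forall S, P S -> is_min (E S) (f S)) & is_max (f @` P) m.

End Extrema.

(* These quotients are compared with the order of R[i], for which z <= w holds
   iff w - z is a nonnegative real; an extremum that is real thus forces all
   of them to be real. *)
Definition two_sided_quotients (R : realType) (n : nat) (A V : 'M[R[i]]_n)
    (S : {vspace 'cV[R[i]]_n}) : set R[i] :=
  [set z | exists x y : 'cV[R[i]]_n,
    [/\ x \in S, y = invmx (V *m V ^t*) *m x, (y ^t* *m x) 0 0 != 0
      & z = (y ^t* *m A *m x) 0 0 / (y ^t* *m x) 0 0]].

Definition subspaces_of_dim (F : fieldType) (vT : vectType F) (k : nat) :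
    set {vspace vT} :=
  [set S | \dim S = k].
Arguments subspaces_of_dim {F} vT k.

(* Main.v *)
Require Import Defs.
From mathcomp Require Import all_boot all_order all_algebra.
From mathcomp Require Import perm spectral complex.
From mathcomp Require Import classical_sets reals zify.

(** Write x = V w.  With y = (V V^* )^-1 x one gets y^* x = w^* w and
y^* A x = w^* Lam w, so the two-sided quotients of A on S are the Rayleigh
quotients of the diagonal matrix Lam on the subspace V^-1 S
([two_sided_quotientsE]).  Since the eigenvalues are real, Lam is hermitian, and
the statement becomes the Courant-Fischer theorem for Lam.

The device used throughout is a Ritz pair (Q, d): a matrix Q with orthonormal
columns such that Q^* Lam Q is the diagonal matrix of d.  In the coordinates
w = Q c the Rayleigh quotient is the weighted mean
(sum_i d_i |c_i|^2) / (sum_i |c_i|^2), so on the column space of Q any bound on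
the d_i bounds every quotient, and each d_i is itself a quotient.  Two
instances are needed.

- Every subspace has a Ritz pair with real d ([ritz_exists]): take an
  orthonormal basis U of it and rotate U by the unitary matrix diagonalizing
  the hermitian compression of Lam to the subspace.  Hence the inner maximum
  and minimum are attained on every nonzero subspace, with no appeal to
  compactness of the sphere.
- Any choice of distinct canonical basis vectors is a Ritz pair of a diagonal
  matrix ([ritz_diag]).  The vectors belonging to lam_1, ..., lam_j span a
  subspace lo of dimension j on which all quotients are at most lam_j; those
  belonging to lam_j, ..., lam_n span a subspace hi of dimension n - j + 1 on
  which all quotients are at least lam_j.

The subspace V lo makes the inner maximum at most lam_j.  Conversely a subspace
of dimension j meets hi in a nonzero vector, so its inner maximum is at least
lam_j.  The max-min formula follows in the same way with lo and hi exchanged. *)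

Set Implicit Arguments.
Unset Strict Implicit.
Unset Printing Implicit Defensive.

Import Order.TTheory GRing.Theory Num.Theory.

Local Open Scope complex_scope.
Local Open Scope ring_scope.
Local Open Scope sesquilinear_scope.

(** * Recognizing a min-max value *)

(** One index whose values are all at most m and a value at least m in every
index pin the min-max to m, once the inner maxima are known to exist; none of
these maxima has to be computed. *)
Lemma is_minmaxI (d : Order.disp_t) (T : porderType d) (I : Type) (P : set I)
    (E : I -> set T) (m : T) :
    (forall S, P S -> exists t, is_max (E S) t) ->
    (exists2 S, P S & ubound (E S) m) ->
    (forall S, P S -> exists2 z, E S z & (m <= z)%O) ->
  is_minmax P E m.
Proof.
move=> Emax [S0 PS0 leS0] geP.
exists (fun S => xget m (is_max (E S))) => [S /Emax/xgetPex //|].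
have maxP S : P S -> is_max (E S) (xget m (is_max (E S))).
  by move=> /Emax/xgetPex; apply.
have ge_max S : P S -> (m <= xget m (is_max (E S)))%O.
  move=> PS; have [z Ez le_mz] := geP S PS.
  by apply: le_trans le_mz _; apply: (maxP S PS).2.
split; last by move=> _ [S PS <-]; apply: ge_max.
exists S0 => //; apply/le_anti; rewrite ge_max // andbT.
exact/leS0/(maxP S0 PS0).1.
Qed.

Lemma is_maxminI (d : Order.disp_t) (T : porderType d) (I : Type) (P : set I)
    (E : I -> set T) (m : T) :
    (forall S, P S -> exists t, is_min (E S) t) ->
    (exists2 S, P S & lbound (E S) m) ->
    (forall S, P S -> exists2 z, E S z & (z <= m)%O) ->
  is_maxmin P E m.
(* In the dual order the maxima become minima and conversely. *)
Proof. exact: (@is_minmaxI _ T^d). Qed.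

(** * Column spaces, dimensions and similarity *)

Section ColumnSpace.
Variables (F : fieldType).

Definition colspace m k (Q : 'M[F]_(m, k)) : {vspace 'cV[F]_m} :=
  limg (linfun (mulmx Q) : 'Hom('cV[F]_k, 'cV[F]_m)).

Lemma colspaceP m k (Q : 'M[F]_(m, k)) (w : 'cV[F]_m) :
  reflect (exists c : 'cV_k, w = Q *m c) (w \in colspace Q).
Proof.
apply: (iffP memv_imgP) => [[c _ ->]|[c ->]]; exists c; rewrite ?lfunE //=.
exact: memvf.
Qed.

Lemma dim_colspace m k (Q : 'M[F]_(m, k)) (P : 'M[F]_(k, m)) :
  P *m Q = 1%:M -> \dim (colspace Q) = k.
Proof.
move=> PQ1; rewrite limg_dim_eq; first by rewrite dimvf /dim /= muln1.
apply/eqP; rewrite capfv; apply/lker0P => u v; rewrite !lfunE /= => eq_uv.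
by rewrite -[u]mul1mx -[v]mul1mx -PQ1 -!mulmxA eq_uv.
Qed.

Lemma dim_limg_unitmx n (V : 'M[F]_n) (W : {vspace 'cV[F]_n}) :
  V \in unitmx -> \dim (linfun (mulmx V) @: W) = \dim W.
Proof.
move=> Vu; rewrite limg_dim_eq //.
have /eqP-> : lker (linfun (mulmx V) : 'End('cV[F]_n)) == 0%VS.
  apply/lker0P => u v; rewrite !lfunE /= => /(congr1 (mulmx (invmx V))).
  by rewrite !mulKmx.
exact: capv0.
Qed.

Lemma cap_neq0 n (U W : {vspace 'cV[F]_n}) :
  (n < \dim U + \dim W)%N -> exists2 w, w != 0 & w \in (U :&: W)%VS.
Proof.
move=> lt_n; exists (vpick (U :&: W)); last exact: memv_pick.
rewrite vpick0 -dimv_eq0 -lt0n -(ltn_add2l (\dim (U + W))) dimv_sum_cap addn0.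
apply: leq_ltn_trans lt_n; apply: leq_trans (dimvS (subvf _)) _.
by rewrite dimvf /dim /= muln1.
Qed.

Lemma char_poly_conj n (V B : 'M[F]_n) :
  V \in unitmx -> char_poly (V *m B *m invmx V) = char_poly B.
Proof.
move=> Vu; rewrite /char_poly.
have VV1 : map_mx polyC V *m map_mx polyC (invmx V) = 1%:M.
  by rewrite -map_mxM mulmxV // map_mx1.
have -> : char_poly_mx (V *m B *m invmx V) =
    map_mx polyC V *m char_poly_mx B *m map_mx polyC (invmx V).
  rewrite /char_poly_mx mulmxBr mulmxBl scalar_mxC.
  rewrite -['X%:M *m _ *m _]mulmxA VV1 mulmx1.
  by rewrite !map_mxM.
by rewrite !det_mulmx mulrAC -det_mulmx VV1 det1 mul1r.
Qed.

End ColumnSpace.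

(** * Rayleigh quotients and Ritz pairs *)

Section RayleighQuotients.
Variables (C : numClosedFieldType) (n : nat).
Implicit Types (L : 'M[C]_n) (W : {vspace 'cV[C]_n}) (t : C).

Definition rayleigh L (w : 'cV[C]_n) : C :=
  (w^t* *m L *m w) 0 0 / (w^t* *m w) 0 0.

Definition rayleigh_set L W : set C :=
  [set z | exists2 w, w != 0 & w \in W /\ z = rayleigh L w].

(** The columns of Q are Ritz vectors of L and the entries of d the
corresponding Ritz values.  The subspace is carried by Q alone, so that both
an abstract subspace and a span of canonical basis vectors fit. *)
Definition ritz L k (Q : 'M[C]_(n, k)) (d : 'rV[C]_k) :=
  Q^t* *m Q = 1%:M /\ Q^t* *m L *m Q = diag_mx d.

Lemma form_diagE k (d : 'rV[C]_k) (c : 'cV[C]_k) :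
  (c^t* *m diag_mx d *m c) 0 0 = \sum_i d 0 i * `|c i 0| ^+ 2.
Proof.
rewrite mul_mx_diag mxE; apply: eq_bigr => i _.
by rewrite !mxE normCK mulrAC mulrC [_^* * _]mulrC.
Qed.

Lemma sqnormE k (c : 'cV[C]_k) : (c^t* *m c) 0 0 = \sum_i `|c i 0| ^+ 2.
Proof.
by rewrite mxE; apply: eq_bigr => i _; rewrite !mxE normCK mulrC.
Qed.

Lemma sqnorm_gt0 k (c : 'cV[C]_k) : c != 0 -> 0 < (c^t* *m c) 0 0.
Proof.
move=> c0; rewrite sqnormE lt_def sumr_ge0 ?andbT => [|i _]; last first.
  exact: exprn_ge0.
apply: contra c0; rewrite psumr_eq0 => [/allP c0|i _]; last exact: exprn_ge0.
apply/eqP/colP => i; rewrite mxE; apply/eqP.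
by have := c0 i (mem_index_enum _); rewrite sqrf_eq0 normr_eq0.
Qed.

Section RitzPair.
Variables (L : 'M[C]_n) (k : nat) (Q : 'M[C]_(n, k)) (d : 'rV[C]_k).
Hypothesis ritzQ : ritz L Q d.

Lemma dim_ritz : \dim (colspace Q) = k.
Proof. exact: dim_colspace ritzQ.1. Qed.

(** In orthonormal coordinates that diagonalize the form, the quotient is a
convex combination of the Ritz values; the bounds below are read off from
this. *)
Lemma ritz_rayleigh (c : 'cV[C]_k) : rayleigh L (Q *m c) =
  (\sum_i d 0 i * `|c i 0| ^+ 2) / (c^t* *m c) 0 0.
Proof.
case: ritzQ => QQ QLQ; rewrite /rayleigh -form_diagE -QLQ.
by rewrite trmx_mul map_mxM !mulmxA -[_ *m Q^t* *m Q]mulmxA QQ mulmx1.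
Qed.

Lemma ritz_neq0 (c : 'cV[C]_k) : Q *m c != 0 -> c != 0.
Proof. by apply: contraNneq => ->; rewrite mulmx0. Qed.

Lemma ritz_ubound t :
  (forall i, d 0 i <= t) -> ubound (rayleigh_set L (colspace Q)) t.
Proof.
move=> le_dt _ [w w0 [/colspaceP[c wE] ->]]; rewrite {}wE in w0 *.
rewrite ritz_rayleigh ler_pdivrMr ?sqnorm_gt0 ?ritz_neq0 //.
rewrite sqnormE mulr_sumr; apply: ler_sum => i _.
by rewrite ler_wpM2r // exprn_ge0.
Qed.

Lemma ritz_lbound t :
  (forall i, t <= d 0 i) -> lbound (rayleigh_set L (colspace Q)) t.
Proof.
move=> le_td _ [w w0 [/colspaceP[c wE] ->]]; rewrite {}wE in w0 *.
rewrite ritz_rayleigh ler_pdivlMr ?sqnorm_gt0 ?ritz_neq0 //.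
rewrite sqnormE mulr_sumr; apply: ler_sum => i _.
by rewrite ler_wpM2r // exprn_ge0.
Qed.

Lemma ritz_value_in i : rayleigh_set L (colspace Q) (d 0 i).
Proof.
have dE l : `|(delta_mx i 0 : 'cV[C]_k) l 0| ^+ 2 = (l == i)%:R.
  by rewrite mxE eqxx andbT; case: eqP;
    rewrite ?normr1 ?normr0 expr2 ?mulr0 ?mulr1.
exists (Q *m delta_mx i 0).
  apply: contra_neq (oner_neq0 C) => /(congr1 (mulmx (Q^t*))).
  rewrite mulmxA ritzQ.1 mul1mx mulmx0 => /matrixP/(_ i 0).
  by rewrite !mxE !eqxx.
split; first by apply/colspaceP; exists (delta_mx i 0).
rewrite ritz_rayleigh sqnormE (bigD1 i) //= [X in _ / X](bigD1 i) //=.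
by rewrite !big1 => [|l|l]; rewrite ?dE ?eqxx ?addr0 ?mulr1 ?divr1 // => /negPf->;
  rewrite ?mulr0.
Qed.

End RitzPair.

(** The Ritz basis is U^* P^*, where the rows of U come from Gram-Schmidt applied
to the conjugate transposes of a basis of W, and the unitary matrix P
diagonalizes the hermitian compression U L U^*. *)
Lemma ritz_exists L W : L^t* = L ->
  exists k (Q : 'M[C]_(n, k)) d,
    [/\ ritz L Q d, colspace Q = W & forall i, d 0 i \is Num.real].
Proof.
move=> Lh; set k := \dim W.
pose B : 'M[C]_(n, k) := \matrix_(i, l) (vbasis W)`_l i 0.
have le_kn : (k <= n)%N.
  by apply: leq_trans (dimvS (subvf W)) _; rewrite dimvf /dim /= muln1.
pose U := schmidt (B^t*).
have UU : U *m U^t* = 1%:M by apply/unitarymxP/schmidt_unitarymx.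
(* Gram-Schmidt gives one inclusion; the other one follows from dimensions. *)
have sWU : (W <= colspace (U^t*))%VS.
  apply/subvP => w /coord_vbasis wE.
  have /submxP[K BKU] : (B^t* <= U)%MS by apply: schmidt_sub.
  apply/colspaceP; exists (K^t* *m \col_l coord (vbasis W) l w).
  rewrite mulmxA -map_mxM -trmx_mul -BKU trmxCK.
  apply/colP => i; rewrite {1}wE summxE mxE; apply: eq_bigr => l _.
  by rewrite !mxE mulrC.
have WU : W = colspace (U^t*).
  by apply/eqP; rewrite eqEdim sWU (dim_colspace UU) leqnn.
pose H := U *m L *m U^t*.
have Hh : H^t* = H.
  by rewrite /H !trmx_mul !map_mxM trmxCK Lh mulmxA.
have Hherm : H \is hermsymmx.
  by apply/is_hermitianmxP; rewrite expr0 scale1r Hh.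
pose P := spectralmx H; pose d := spectral_diag H.
have Pu : P \is unitarymx by apply: spectral_unitarymx.
have PP : P *m P^t* = 1%:M by apply/unitarymxP.
have PP' : P^t* *m P = 1%:M by apply: mulmx1C.
have HE : H = P^t* *m diag_mx d *m P.
  rewrite -invmx_unitary //.
  exact/orthomx_spectralP/hermitian_normalmx.
exists k, (U^t* *m P^t*), d; split.
- rewrite /ritz trmx_mul map_mxM !trmxCK; split.
    by rewrite mulmxA -[P *m U *m _]mulmxA UU mulmx1.
  have -> : P *m U *m L *m (U^t* *m P^t*) = P *m H *m P^t*.
    by rewrite /H !mulmxA.
  by rewrite HE !mulmxA PP mul1mx -mulmxA PP mulmx1.
- rewrite WU; apply/vspaceP => w; apply/colspaceP/colspaceP => -[c ->].
    by exists (P^t* *m c); rewrite mulmxA.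
  by exists (P *m c); rewrite mulmxA -[_ *m P]mulmxA PP' mulmx1.
- by move=> i; have /mxOverP := hermitian_spectral_diag_real Hherm; apply.
Qed.

(** The largest Ritz value bounds all the quotients and is one of them, which
replaces the usual compactness argument. *)
Lemma rayleigh_set_max L W : L^t* = L -> (0 < \dim W)%N ->
  exists m, is_max (rayleigh_set L W) m.
Proof.
move=> /(ritz_exists W) [k [Q [d [ritzQ <- dreal]]]].
rewrite (dim_ritz ritzQ) => k0.
have [//|i _ imax] := @real_arg_maxP _ _ (Ordinal k0) predT (d 0) isT.
exists (d 0 i); split; first exact: ritz_value_in ritzQ i.
by apply: ritz_ubound ritzQ _ _ => // l; apply: imax.
Qed.

Lemma rayleigh_set_min L W : L^t* = L -> (0 < \dim W)%N ->
  exists m, is_min (rayleigh_set L W) m.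
Proof.
move=> /(ritz_exists W) [k [Q [d [ritzQ <- dreal]]]].
rewrite (dim_ritz ritzQ) => k0.
have [//|i _ imin] := @real_arg_minP _ _ (Ordinal k0) predT (d 0) isT.
exists (d 0 i); split; first exact: ritz_value_in ritzQ i.
by apply: ritz_lbound ritzQ _ _ => // l; apply: imin.
Qed.

Lemma ritz_diag k (l : 'rV[C]_n) (f : 'I_k -> 'I_n) : injective f ->
  ritz (diag_mx l) (colsub f 1%:M) (colsub f l).
Proof.
move=> finj; split.
  apply/matrixP => a b; rewrite !mxE (bigD1 (f b)) //= big1 => [|i ne_ib].
    by rewrite !mxE eqxx mulr1 addr0 inj_eq // rmorph_nat eq_sym.
  by rewrite !mxE (negPf ne_ib) mulr0.
rewrite mul_mx_diag.
apply/matrixP => a b; rewrite !mxE (bigD1 (f b)) //= big1 => [|i ne_ib].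
  rewrite !mxE eqxx mulr1 addr0 inj_eq // rmorph_nat [b == a]eq_sym.
  by case: eqP => [->|_]; rewrite ?mul1r ?mul0r.
by rewrite !mxE (negPf ne_ib) mulr0.
Qed.

End RayleighQuotients.

(** * From two-sided quotients to eigenvalues of the diagonal matrix *)

(** The left vector y = (V V^* )^-1 V w satisfies y^* V = w^*: this is what makes
the nonnormal problem for A a hermitian problem for Lam. *)
Lemma two_sided_quotientsE (R : realType) (n : nat) (V Lam : 'M[R[i]]_n)
    (W : {vspace 'cV[R[i]]_n}) : V \in unitmx ->
  two_sided_quotients (V *m Lam *m invmx V) V (linfun (mulmx V) @: W) =
  rayleigh_set Lam W.
Proof.
move=> Vu.
pose N := invmx (V *m V^t*) *m V.
have NV : N^t* *m V = 1%:M.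
  have VVu : V *m V^t* \in unitmx.
    by rewrite unitmx_mul Vu map_unitmx unitmx_tr.
  apply: mulmx1C; rewrite -[V in LHS]trmxCK -map_mxM -trmx_mul.
  by rewrite -mulmxA mulVmx // trmx1 map_mx1.
pose y (w : 'cV_n) := invmx (V *m V^t*) *m (V *m w).
have yV (w u : 'cV_n) : (y w)^t* *m (V *m u) = w^t* *m u.
  by rewrite [y w]mulmxA trmx_mul map_mxM -mulmxA [N^t* *m _]mulmxA NV mul1mx.
have yAV (w : 'cV_n) :
  (y w)^t* *m (V *m Lam *m invmx V) *m (V *m w) = w^t* *m Lam *m w.
  by rewrite -!mulmxA mulKmx // yV.
apply/seteqP; split=> z /=.
  move=> [x [_ [/memv_imgP[w wW ->] ->]]].
  rewrite lfunE /= -/(y w) yV yAV => ww0 ->.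
  exists w => //; apply: contraNneq ww0 => ->.
  by rewrite mulmx0 mxE.
move=> [w w0 [wW ->]]; exists (V *m w), (y w).
split=> //; last by rewrite yV yAV.
  by apply/memv_imgP; exists w; rewrite ?lfunE.
by rewrite yV gt_eqF ?sqnorm_gt0.
Qed.

(** The columns of V come in no particular order, so the ordered eigenvalues
match the diagonal only up to a permutation s. *)
Lemma diag_eigenvalues (R : realType) n (Lam : 'M[R[i]]_n) (lam : n.-tuple R) :
    is_diag_mx Lam ->
    char_poly Lam = \prod_(l <- lam) ('X - (l%:C)%:P) ->
  exists2 s : 'I_n -> 'I_n, injective s &
    forall i, Lam (s i) (s i) = (lam`_i)%:C.
Proof.
move=> /is_diag_mx_is_trig/char_poly_trig-> charE.
pose diag := [tuple Lam i i | i < n].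
have /tuple_permP[p pE] : perm_eq [seq l%:C | l <- lam] diag.
  apply: prod_XsubC_eq; rewrite big_map -charE.
  by rewrite big_map big_enum.
exists p => [|i]; first exact: perm_inj.
have := congr1 (fun u => u`_i) pE.
rewrite (nth_map 0) ?size_tuple // => ->.
by rewrite -tnth_nth !tnth_mktuple.
Qed.

Theorem theorem4p6 (R : realType) (j n : nat) (hj : (1 <= j <= n)%N)
    (A V Lam : 'M[R[i]]_n)
    (hV : V \in unitmx) (hLam : is_diag_mx Lam) (hA : A = V *m Lam *m invmx V)
    (lam : n.-tuple R)
    (hlam : char_poly A = \prod_(l <- lam) ('X - (l%:C)%:P))
    (hsorted : sorted <=%R lam) :
  is_minmax (subspaces_of_dim 'cV[R[i]]_n j)
    (two_sided_quotients A V) (lam`_(j.-1))%:C /\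
  is_maxmin (subspaces_of_dim 'cV[R[i]]_n (n - j + 1))
    (two_sided_quotients A V) (lam`_(j.-1))%:C.
Proof.
have /andP[j_gt0 le_jn] := hj; rewrite {}hA in hlam *.
rewrite char_poly_conj // in hlam.
have [s s_inj lamE] := diag_eigenvalues hLam hlam.
have /is_diag_mxP Ldiag := hLam.
pose l : 'rV[R[i]]_n := \row_i Lam i i.
have LE : Lam = diag_mx l.
  apply/matrixP => a b; rewrite !mxE.
  by have [->|/Ldiag->] := eqVneq a b; rewrite ?mulr1n.
have lE i : l 0 (s i) = (lam`_i)%:C by rewrite mxE lamE.
have le_l (a b : 'I_n) : (a <= b)%N -> l 0 (s a) <= l 0 (s b).
  move=> le_ab; rewrite !lE lecR.
  by apply: (sorted_leq_nth le_trans lexx) => //; rewrite inE size_tuple.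
have Lherm : Lam^t* = Lam.
  rewrite LE tr_diag_mx map_diag_mx; congr diag_mx.
  apply/rowP => a; have [b ->] : exists b, a = s b.
    by have /codomP := (injF_onto s_inj) a.
  by rewrite mxE lE; apply/CrealP/complex_realP; exists lam`_b.
have lt_jn : (j.-1 < n)%N by rewrite prednK.
pose m := Ordinal lt_jn; have -> : (lam`_j.-1)%:C = l 0 (s m) by rewrite lE.
(* Both subspaces contain the canonical vector of index s m; their dimensions
   add up to n + 1. *)
pose lo := colspace
  (colsub (fun i => s (widen_ord le_jn i)) (1%:M : 'M[R[i]]_n)).
have hi_lt (i : 'I_(n - j + 1)) : (j.-1 + i < n)%N.
  by case: i => i /=; lia.
pose hi := colspace
  (colsub (fun i => s (Ordinal (hi_lt i))) (1%:M : 'M[R[i]]_n)).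
have lo_inj : injective (fun i => s (widen_ord le_jn i)).
  by move=> a b /s_inj[/val_inj].
have ritz_lo := ritz_diag l lo_inj.
have hi_inj : injective (fun i => s (Ordinal (hi_lt i))).
  by move=> a b /s_inj[/addnI/val_inj].
have ritz_hi := ritz_diag l hi_inj; rewrite -LE in ritz_lo ritz_hi.
have dim_lo : \dim lo = j := dim_ritz ritz_lo.
have dim_hi : \dim hi = (n - j + 1)%N := dim_ritz ritz_hi.
have le_lo : ubound (rayleigh_set Lam lo) (l 0 (s m)).
  apply: ritz_ubound ritz_lo _ _ => i; rewrite [leLHS]mxE; apply: le_l => /=.
  by rewrite -ltnS prednK.
have ge_hi : lbound (rayleigh_set Lam hi) (l 0 (s m)).
  apply: ritz_lbound ritz_hi _ _ => i; rewrite [leRHS]mxE; apply: le_l => /=.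
  exact: leq_addr.
have tsqP (S : {vspace 'cV[R[i]]_n}) : exists2 W, \dim W = \dim S &
    two_sided_quotients (V *m Lam *m invmx V) V S = rayleigh_set Lam W.
  exists (linfun (mulmx (invmx V)) @: S)%VS.
    by rewrite dim_limg_unitmx ?unitmx_inv.
  rewrite -(two_sided_quotientsE _ _ hV); congr (two_sided_quotients _ _ _).
  apply/vspaceP => x; rewrite -limg_comp; congr (_ \in _).
  rewrite (_ : (_ \o _)%VF = \1%VF) ?lim1g //.
  by apply/lfunP => u; rewrite !lfunE /= !lfunE /= mulKVmx.
split.
- apply: is_minmaxI => [S SE||S SE].
  + have [W WE ->] := tsqP S; apply: rayleigh_set_max => //.
    by rewrite WE SE.
  + exists (linfun (mulmx V) @: lo)%VS; last by rewrite two_sided_quotientsE.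
    by rewrite /subspaces_of_dim /= dim_limg_unitmx.
  + have [W WE ->] := tsqP S.
    have [|w w0 /memv_capP[wW whi]] := @cap_neq0 _ _ W hi.
      by rewrite dim_hi WE SE; lia.
    by exists (rayleigh Lam w); [exists w|apply: ge_hi; exists w].
- apply: is_maxminI => [S SE||S SE].
  + have [W WE ->] := tsqP S; apply: rayleigh_set_min => //.
    by rewrite WE SE addn1.
  + exists (linfun (mulmx V) @: hi)%VS; last by rewrite two_sided_quotientsE.
    by rewrite /subspaces_of_dim /= dim_limg_unitmx.
  + have [W WE ->] := tsqP S.
    have [|w w0 /memv_capP[wW wlo]] := @cap_neq0 _ _ W lo.
      by rewrite dim_lo WE SE; lia.
    by exists (rayleigh Lam w); [exists w|apply: le_lo; exists w].
Qed.
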